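(* Let $G$ be a connected threshold graph with $n$ vertices and trace $T=n-3$. In the following, all $t_i$ are integers with $t_i\ge 1$. (1) If $G\cong(0,\underbrace{1,\ldots,1}_{t_1},0,\underbrace{1,\ldots,1}_{t_2},0,\underbrace{1,\ldots,1}_{t_3})$, then $q(G)=3$ if $t_3=1$, and $q(G)=2$ otherwise. (2) If $G\cong(0,0,0,\underbrace{1,\ldots,1}_{t_1})$, then $q(G)=2$ if $t_1\ge 3$, and $q(G)=3$ if $t_1\in\{1,2\}$. (3) If $G\cong(0,0,\underbrace{1,\ldots,1}_{t_1},0,\underbrace{1,\ldots,1}_{t_2})$, then $q(G)=3$ if $t_2=1$, and $q(G)=2$ if $t_2\ge 2$. (4) If $G\cong(0,\underbrace{1,\ldots,1}_{t_1},0,0,\underbrace{1,\ldots,1}_{t_2})$, then $q(G)=3$ if $t_2\in\{1,2\}$, and $q(G)=2$ if $t_2\ge 3$.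
   Context: For a simple graph $G$ on $n$ vertices, $S(G)$ is the set of all real symmetric $n\times n$ matrices $A=(a_{ij})$ such that for $i\neq j$, $a_{ij}\neq 0$ if and only if $ij\in E(G)$ (diagonal entries are unrestricted). $q(A)$ is the number of distinct eigenvalues of $A$ and $q(G)=\min\{q(A): A\in S(G)\}$. The notation $G\cong(b_1,\ldots,b_n)$, with $b_i\in\{0,1\}$ and $b_1=0$, means that $G$ is the threshold graph with creation sequence $(b_1,\ldots,b_n)$: its vertices are $v_1,\ldots,v_n$ and, for $i<j$, $v_i$ and $v_j$ are adjacent if and only if $b_j=1$. Connected threshold graphs are those with $b_n=1$. The trace $T$ of $G$ is the number of indices $i$ with $b_i=1$. *)

(* Defs.v *)
From mathcomp Require Import all_boot all_order all_algebra.
From mathcomp Require Import finmap.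
From mathcomp Require Import boolp classical_sets cardinality reals.

Set Implicit Arguments.
Unset Strict Implicit.
Unset Printing Implicit Defensive.

Import GRing.Theory.

Local Open Scope classical_set_scope.
Local Open Scope ring_scope.

Record simple_graph (n : nat) := SimpleGraph {
  adj :> rel 'I_n;
  adj_sym : symmetric adj;
  adj_irrefl : irreflexive adj
}.

Definition graph_iso (n : nat) (G H : simple_graph n) : Prop :=
  exists2 f : 'I_n -> 'I_n, bijective f & forall i j, H (f i) (f j) = G i j.

Definition connected_graph (n : nat) (G : simple_graph n) : Prop :=
  (0 < n)%N /\ forall i j : 'I_n, connect G i j.

Definition sym_matrices (R : realType) (n : nat) (G : simple_graph n) :
    set 'M[R]_n :=
  [set A | A^T = A /\ forall i j : 'I_n, i != j -> (A i j != 0 <-> G i j)].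

Definition eigenvalues (R : realType) (n : nat) (A : 'M[R]_n) : set R :=
  [set a | eigenvalue A a].

Definition num_eigenvalues (R : realType) (n : nat) (A : 'M[R]_n) : nat :=
  #|` fset_set (eigenvalues A)|%fset.

(* [fset_set] is empty on infinite sets; [finite_eigenvalues] shows that
   [num_eigenvalues] never meets this case. *)
Lemma finite_root (R : fieldType) (p : {poly R}) :
  p != 0 -> finite_set [set a | root p a].
Proof.
elim: {p}(size p) {-2}p (leqnn (size p)) => [|m IH] p.
  by rewrite leqn0 size_poly_eq0 => ->.
move=> sp p0; case: (pselect (exists a, root p a)) => [[a]|nr]; last first.
  by apply: (sub_finite_set _ (finite_set0 R)) => a ra; exact: nr (ex_intro _ a ra).
case/factor_theorem => q pq.
have q0 : q != 0 by apply: contra p0 => /eqP; rewrite pq => ->; rewrite mul0r.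
have sq : (size q <= m)%N.
  by move: sp; rewrite pq size_Mmonic ?monicXsubC // size_XsubC addn2.
apply: (sub_finite_set _ (_ : finite_set ([set a | root q a] `|` [set a]))).
  by move=> c /=; rewrite pq rootM root_XsubC => /orP[->|/eqP ->]; [left|right].
by rewrite finite_setU; split; [exact: IH|exact: finite_set1].
Qed.

Lemma finite_eigenvalues (R : realType) (n : nat) (A : 'M[R]_n) :
  finite_set (eigenvalues A).
Proof.
have p0 : char_poly A != 0 by rewrite monic_neq0 // char_poly_monic.
apply: (sub_finite_set _ (finite_root p0)) => a /=.
by rewrite /eigenvalues /= eigenvalue_root_char.
Qed.

Lemma ex_num_eigenvalues (R : realType) (n : nat) (G : simple_graph n) :
  exists k : nat,
    `[< exists2 A : 'M[R]_n, sym_matrices G A & num_eigenvalues A = k >].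
Proof.
pose A : 'M[R]_n := \matrix_(i, j) (G i j)%:R.
exists (num_eigenvalues A); apply/asboolP; exists A => //; split.
  by apply/matrixP => i j; rewrite !mxE adj_sym.
by move=> i j _; rewrite mxE; case: (G i j); rewrite ?oner_eq0 ?eqxx.
Qed.

Definition q (R : realType) (n : nat) (G : simple_graph n) : nat :=
  ex_minn (ex_num_eigenvalues R G).

(* Positions in [b] are numbered from 0, so [nth false b i] is b_{i+1}. *)
Definition threshold_adj (n : nat) (b : seq bool) : rel 'I_n :=
  fun i j => ((i < j)%N && nth false b j) || ((j < i)%N && nth false b i).

Lemma threshold_adj_sym (n : nat) (b : seq bool) :
  symmetric (@threshold_adj n b).
Proof. by move=> i j; rewrite /threshold_adj orbC. Qed.

Lemma threshold_adj_irrefl (n : nat) (b : seq bool) :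
  irreflexive (@threshold_adj n b).
Proof. by move=> i; rewrite /threshold_adj ltnn. Qed.

Definition threshold_graph (n : nat) (b : seq bool) : simple_graph n :=
  SimpleGraph (@threshold_adj_sym n b) (@threshold_adj_irrefl n b).

(* The default [true] of [head] makes the empty sequence inadmissible. *)
Definition has_creation_sequence (n : nat) (G : simple_graph n)
    (b : seq bool) : Prop :=
  [/\ size b = n, head true b = false & graph_iso G (threshold_graph n b)].

Definition trace (b : seq bool) : nat := count id b.

(* Main.v *)
(* All four families are the graphs (0,1^a,0,1^c1,0,1^c2) with a, c1 >= 0 and
   c2 >= 1, each of them a blow-up of a threshold graph on at most 6 vertices,
   in which vertices are replaced by cliques of adjacent twins.
   Upper bounds: represent the small graph by vectors w_c of R^3, adjacency
   being non-orthogonality, such that W^T W is diagonal. Giving each vertex of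
   the blow-up the vector w_c divided by the square root of the size of its
   class c leaves W^T W unchanged, and the Gram matrix then has no
   eigenvalue other than 0 and the diagonal entries of W^T W.
   Lower bounds: a symmetric A with at most two eigenvalues satisfies
   A^2 = s A + t I, so the rows of non-adjacent vertices are orthogonal. This is
   impossible for two vertices with a single common neighbour, and for three
   pairwise non-adjacent vertices sharing the same two common neighbours. *)
Require Import Defs.
From mathcomp Require Import all_boot all_order all_algebra.
From mathcomp Require Import finmap.
From mathcomp Require Import boolp classical_sets cardinality reals.
From mathcomp Require Import complex.
From mathcomp Require Import zify ring.

Set Implicit Arguments.
Unset Strict Implicit.
Unset Printing Implicit Defensive.

Import Order.TTheory GRing.Theory Num.Theory.
Local Open Scope ring_scope.

(** * Spectra of symmetric matrices and general facts on [q] *)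

Lemma num_eigenvalues_le (R : realType) n (A : 'M[R]_n) (S : seq R) :
  (forall a, eigenvalue A a -> a \in S) -> (num_eigenvalues A <= size S)%N.
Proof.
move=> AS; rewrite /num_eigenvalues.
apply: (@leq_trans #|` [fset a in S]%fset|); last first.
  by rewrite card_fseq size_undup.
apply/fsubset_leq_card/fsubsetP => a.
rewrite in_fset_set; last exact: finite_eigenvalues.
by move=> /set_mem /AS aS; rewrite !inE.
Qed.

Lemma eigenvalue_in_fset (R : realType) n (A : 'M[R]_n) a :
  eigenvalue A a -> a \in fset_set (eigenvalues A).
Proof.
by move=> Aa; rewrite in_fset_set ?mem_set //; exact: finite_eigenvalues.
Qed.

Lemma q_le (R : realType) n (G : simple_graph n) (A : 'M[R]_n) :
  sym_matrices G A -> (q R G <= num_eigenvalues A)%N.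
Proof.
move=> GA; rewrite /q; case: ex_minnP => m _; apply.
by apply/asboolP; exists A.
Qed.

Lemma q_attained (R : realType) n (G : simple_graph n) :
  exists2 A : 'M[R]_n, sym_matrices G A & num_eigenvalues A = q R G.
Proof. by rewrite /q; case: ex_minnP => m /asboolP. Qed.

(** A symmetric matrix is diagonalisable, so simple factors suffice whatever the multiplicities. The
    spectral theorem is applied over the complex extension, where [A] becomes hermitian, and the
    result is pulled back by injectivity. *)
Lemma sym_annihilated (R : realType) n (A : 'M[R]_n.+1) (S : seq R) :
  A^T = A -> (forall a, eigenvalue A a -> a \in S) ->
  horner_mx A (\prod_(a <- S) ('X - a%:P)) = 0.
Proof.
move=> symA AS; pose toC := real_complex R.
pose B := map_mx toC A; pose D := spectral_diag B; pose P := spectralmx B.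
have Pu : P \in unitmx by exact: spectral_unit.
have hermB : B \is hermsymmx.
  apply: realsym_hermsym; last first.
    by apply/mxOverP => i j; rewrite mxE; apply/complex_realP; exists (A i j).
  apply/is_hermitianmxP.
  by rewrite expr0 scale1r; apply/matrixP => i j; rewrite !mxE -{1}symA mxE.
have /orthomx_spectralP BE := hermitian_normalmx hermB.
(* Diagonal entries of a hermitian spectral form are real. Row [j] of the invertible [P] is an
   eigenvector for the [j]-th entry, which is therefore an eigenvalue of [A] itself. *)
have Deig j : exists2 a, D 0 j = toC a & a \in S.
  have /mxOverP/(_ 0 j) Dr := hermitian_spectral_diag_real hermB.
  exists (complex.Re (D 0 j)); first by rewrite /toC /= RRe_real.
  apply: AS; rewrite eigenvalue_root_char.
  rewrite -(fmorph_root toC) map_char_poly -/B -eigenvalue_root_char.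
  rewrite /= RRe_real //; apply/eigenvalueP; exists (row j P); last first.
    apply/eqP => r0; have := row_mul j P (invmx P).
    rewrite mulmxV // r0 mul0mx => /rowP/(_ j); rewrite !mxE eqxx => /eqP.
    by rewrite oner_eq0.
  rewrite [X in _ *m X]BE -!row_mul !mulmxA mulmxV // mul1mx row_mul.
  by rewrite row_diag_mx -scalemxAl -rowE.
apply: (@map_mx_inj _ _ toC); rewrite map_horner_mx -/B BE horner_mx_uconjC //.
rewrite horner_mx_diag [X in diag_mx X](_ : _ = 0).
  by rewrite linear0 mulmx0 mul0mx map_mx0.
apply/rowP => j; rewrite !mxE; have [a -> aS] := Deig j.
rewrite horner_map horner_prod (big_rem a) //= !hornerE subrr mul0r.
by rewrite rmorph0.
Qed.

(** An optimal matrix for [H], with rows and columns permuted by [f], fits [G]; eigenvectors are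
    transported by the same permutation. *)
Lemma q_le_iso (R : realType) n (G H : simple_graph n) :
  graph_iso G H -> (q R G <= q R H)%N.
Proof.
case=> f [g fK gK] GH; have [A [symA HA] <-] := q_attained R H.
pose B : 'M[R]_n := \matrix_(i, j) A (f i) (f j).
have GB : sym_matrices G B.
  split; first by apply/matrixP => i j; rewrite !mxE -{1}symA mxE.
  move=> i j ij; rewrite mxE -GH; apply: HA.
  by apply: contra ij => /eqP/(can_inj fK)->.
apply: leq_trans (q_le GB) _; apply: num_eigenvalues_le => a.
case/eigenvalueP => v vB v0; apply: eigenvalue_in_fset.
apply/eigenvalueP; exists (\row_j v 0 (g j)).
  apply/rowP => j; have /rowP/(_ (g j)) := vB; rewrite !mxE => <-.
  rewrite (reindex f) /=; last by exists g => ? _; rewrite ?fK ?gK.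
  by apply: eq_bigr => i _; rewrite !mxE fK gK.
apply: contra_neq v0 => /rowP v0; apply/rowP => j.
by have := v0 (f j); rewrite !mxE fK.
Qed.

Lemma q_creation_sequence (R : realType) n (G : simple_graph n) b :
  has_creation_sequence G b -> q R G = q R (threshold_graph n b).
Proof.
case=> _ _ iGH; apply/eqP; rewrite eqn_leq q_le_iso //= q_le_iso //.
case: iGH => f [g fK gK] GH; exists g; first by exists f.
by move=> i j; rewrite -GH !gK.
Qed.

(** With a single eigenvalue [A] would be scalar, leaving no edge. *)
Lemma q_gt1 (R : realType) n (G : simple_graph n) i j : G i j -> (1 < q R G)%N.
Proof.
case: n G i j => [|n] G i j Gij; first by case: i Gij.
have ij : i != j by apply: contraTneq Gij => ->; rewrite adj_irrefl.
have [A [symA GA] <-] := q_attained R G; rewrite ltnNge; apply/negP => le1.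
pose s := enum_fset (fset_set (eigenvalues A)).
have := @sym_annihilated _ _ A [:: nth 0 s 0] symA.
rewrite big_seq1 rmorphB /= horner_mx_X horner_mx_C => A0.
have /eqP := (GA i j ij).2 Gij; apply.
have /matrixP/(_ i j) : A - (nth 0 s 0)%:M = 0.
  apply: A0 => a Aa; have : a \in s by exact: eigenvalue_in_fset.
  move: le1; rewrite /num_eigenvalues -[#|` _|%fset]/(size s).
  by case: s => [|x [|]].
by rewrite !mxE (negPf ij) subr0.
Qed.

(** The off-diagonal entry at a non-edge of (A - xI)(A - yI) = 0 is that of A^2, since [A i j]
    vanishes. *)
Lemma q_le2_orthogonal (R : realType) n (G : simple_graph n) :
  (q R G <= 2)%N -> exists2 A : 'M[R]_n, sym_matrices G A &
  forall i j, i != j -> ~~ G i j -> \sum_k A i k * A j k = 0.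
Proof.
have [A GA <-] := q_attained R G => le2; exists A => //; case: GA => symA GA.
case: n G A symA GA le2 => [|n] G A symA GA le2 i j; first by case: i.
move=> ij /negP Gij.
(* If [s] has fewer than two entries, the default 0 of [nth] merely adds a root to the annihilating
   polynomial. *)
pose s := enum_fset (fset_set (eigenvalues A)).
have := @sym_annihilated _ _ A [:: nth 0 s 0; nth 0 s 1] symA.
rewrite big_cons big_seq1 rmorphM !rmorphB /= horner_mx_X !horner_mx_C => A0.
have Aij : A i j = 0 by apply/eqP/negPn/negP => /(GA i j ij).
have : (A - (nth 0 s 0)%:M) *m (A - (nth 0 s 1)%:M) = 0.
  apply: A0 => a Aa; have : a \in s by exact: eigenvalue_in_fset.
  move: le2; rewrite /num_eigenvalues -[#|` _|%fset]/(size s).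
  by case: s => [|x [|y [|]]] //= _; rewrite !inE => ->.
rewrite mulmxBl !mulmxBr mul_scalar_mx mul_mx_scalar -scalar_mxM.
move=> /matrixP/(_ i j); rewrite !mxE Aij (negPf ij) !mulr0 mulr0n !subr0 => A2.
by rewrite -[RHS]A2; apply: eq_bigr => k _; rewrite -{2}symA mxE.
Qed.

(** * Lower bounds from common neighbours *)

Section CommonNeighbours.
Variables (R : realType) (n : nat) (G : simple_graph n).

Let common i j := [pred k | G i k && G j k].

(** The unrestricted diagonal entries do no harm: at k = i and k = j they are multiplied by [A j i]
    or [A i j], which is 0. *)
Lemma sum_common_neighbours (A : 'M[R]_n) i j :
  sym_matrices G A -> i != j -> ~~ G i j ->
  \sum_k A i k * A j k = \sum_(k | common i j k) A i k * A j k.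
Proof.
case=> _ GA ij Gij; have A0 x y : x != y -> ~~ G x y -> A x y = 0.
  by move=> xy; apply: contraNeq => /(GA x y xy).
rewrite [RHS]big_mkcond; apply: eq_bigr => k _ /=.
case: ifP => // /negbT; rewrite negb_and => Gk.
have [->|ik] := eqVneq k i.
  by rewrite (A0 j i) ?mulr0 1?eq_sym // adj_sym.
have [->|jk] := eqVneq k j; first by rewrite (A0 i j) ?mul0r.
by case/orP: Gk => /A0 ->; rewrite ?mulr0 ?mul0r // eq_sym.
Qed.

Lemma q_gt2_unique_common_neighbour i j k :
  i != j -> ~~ G i j -> common i j =1 pred1 k -> (2 < q R G)%N.
Proof.
move=> ij Gij cij; rewrite ltnNge; apply/negP => /q_le2_orthogonal[A GA].
move=> /(_ i j ij Gij); rewrite (sum_common_neighbours GA) // (eq_bigl _ _ cij).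
rewrite big_pred1_eq => /eqP.
have /andP[Gik Gjk] : common i j k by rewrite cij /= eqxx.
have neq x : G x k -> x != k by apply: contraTneq => ->; rewrite adj_irrefl.
case: GA => _ GA; rewrite mulf_eq0 => /orP[] /eqP; apply/eqP.
  exact: (GA _ _ (neq _ Gik)).2.
exact: (GA _ _ (neq _ Gjk)).2.
Qed.

(* Three pairwise orthogonal vectors of R^2 cannot all have nonzero entries. *)
Lemma q_gt2_two_common_neighbours i1 i2 i3 k l :
  uniq [:: i1; i2; i3] -> ~~ G i1 i2 -> ~~ G i1 i3 -> ~~ G i2 i3 -> k != l ->
  common i1 i2 =1 pred2 k l -> common i1 i3 =1 pred2 k l ->
  common i2 i3 =1 pred2 k l -> (2 < q R G)%N.
Proof.
rewrite /= !inE negb_or !andbT => /andP[/andP[n12 n13] n23].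
move=> G12 G13 G23 kl c12 c13 c23.
rewrite ltnNge; apply/negP => /q_le2_orthogonal[A GA ortho].
have sum2 x y : x != y -> ~~ G x y -> common x y =1 pred2 k l ->
    A x k * A y k = - (A x l * A y l).
  move=> xy Gxy cxy; apply/eqP; rewrite -addr_eq0; apply/eqP.
  rewrite -[RHS](ortho x y) // (sum_common_neighbours GA) //.
  rewrite (eq_bigl _ _ cxy) (bigD1 k) /= ?eqxx // (big_pred1 l) // => m /=.
  by have [->|] := eqVneq m k; rewrite ?(negPf kl) //= andbT.
have nz x : G x k -> A x k != 0.
  move=> Gxk; apply: (GA.2 x k _).2 => //.
  by apply: contraTneq Gxk => ->; rewrite adj_irrefl.
have /andP[/nz a1 /nz a2] : common i1 i2 k by rewrite c12 /= eqxx.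
have /andP[_ /nz a3] : common i1 i3 k by rewrite c13 /= eqxx.
have e12 := sum2 _ _ n12 G12 c12.
have e13 := sum2 _ _ n13 G13 c13.
have e23 := sum2 _ _ n23 G23 c23.
(* Multiplying the three orthogonality relations gives x^2 = -y^2, where x and y are the products of
   the three entries in columns [k] and [l]. *)
have : (A i1 k * A i2 k * A i3 k) ^+ 2 + (A i1 l * A i2 l * A i3 l) ^+ 2 = 0.
  have -> : (A i1 k * A i2 k * A i3 k) ^+ 2
      = (A i1 k * A i2 k) * (A i1 k * A i3 k) * (A i2 k * A i3 k) by ring.
  by rewrite e12 e13 e23; ring.
move/eqP; rewrite paddr_eq0 ?sqr_ge0 // sqrf_eq0 !mulf_eq0.
by rewrite (negPf a1) (negPf a2) (negPf a3).
Qed.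

End CommonNeighbours.

(** * Upper bounds from Gram matrices of blow-ups *)

(** If v is an eigenvector of V V^T for a, then either vV = 0 and a = 0, or vV is an eigenvector of
    V^T V = diag d for a, so that a is an entry of d. *)
Lemma q_le_gram (R : realType) n (G : simple_graph n) k r (W : 'M[R]_(k, r))
    (phi : 'I_n -> 'I_k) (d : 'rV[R]_r) (S : seq R) :
  (forall c, exists i, phi i = c) ->
  (forall i j, i != j -> G i j = ((W *m W^T) (phi i) (phi j) != 0)) ->
  W^T *m W = diag_mx d -> 0 \in S -> (forall j, d 0 j \in S) ->
  (q R G <= size S)%N.
Proof.
move=> phi_onto GW WW S0 Sd.
pose m c : R := #|[pred i | phi i == c]|%:R.
have m_gt0 c : 0 < m c.
  rewrite ltr0n; apply/card_gt0P; have [i <-] := phi_onto c.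
  by exists i; rewrite inE.
have s_neq0 c : (Num.sqrt (m c))^-1 != 0.
  by rewrite invr_eq0 lt0r_neq0 // sqrtr_gt0.
pose V : 'M[R]_(n, r) := \matrix_(i, j) (W (phi i) j / Num.sqrt (m (phi i))).
have VV : V^T *m V = diag_mx d.
  rewrite -WW; apply/matrixP => i j; rewrite !mxE.
  rewrite (partition_big phi xpredT) //=; apply: eq_bigr => c _.
  (* On class [c] the summand is constant, and its [m c] copies cancel the denominator [m c]. *)
  rewrite (eq_bigr (fun=> W c i * W c j / m c)).
    rewrite sumr_const -mulr_natr -[_%:R]/(m c) mulfVK ?mxE //.
    by rewrite lt0r_neq0.
  move=> x /eqP <-; rewrite !mxE mulrACA -invfM -expr2 sqr_sqrtr // ltW.
have GV : sym_matrices G (V *m V^T).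
  split; first by rewrite trmx_mul trmxK.
  move=> i j ij; rewrite GW //.
  suff -> : (V *m V^T) i j = (W *m W^T) (phi i) (phi j)
      * ((Num.sqrt (m (phi i)))^-1 * (Num.sqrt (m (phi j)))^-1).
    by rewrite mulf_eq0 mulf_eq0 !(negPf (s_neq0 _)) !orbF.
  rewrite !mxE mulr_suml; apply: eq_bigr => c _; rewrite !mxE.
  by rewrite mulrACA.
apply: leq_trans (q_le GV) _; apply: num_eigenvalues_le => a.
case/eigenvalueP => v vM v0; have [u0|u0] := eqVneq (v *m V) 0.
  suff -> : a = 0 by [].
  apply/eqP; move/eqP: vM; rewrite mulmxA u0 mul0mx eq_sym scaler_eq0.
  by rewrite (negPf v0) orbF.
have /matrix0Pn[i [j]] := u0; rewrite ord1 => uj.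
suff -> : a = d 0 j by [].
have : v *m V *m diag_mx d = a *: (v *m V).
  by rewrite -VV !mulmxA -(mulmxA v) vM scalemxAl.
move/rowP/(_ j); rewrite mul_mx_diag !mxE [LHS]mulrC => /mulIf->//.
by rewrite mxE in uj.
Qed.

Definition dot3 (u v : seq int) : int :=
  u`_0 * v`_0 + u`_1 * v`_1 + u`_2 * v`_2.

(** Integer vectors make this decidable by computation. The case c = c' asks for nonzero vectors, so
    that vertices of one class become adjacent; [maxn] picks the later vertex, whose bit decides
    adjacency. *)
Definition represents (w : seq (seq int)) (b : seq bool) : bool :=
  all (fun c => all (fun c' => (dot3 (nth [::] w c) (nth [::] w c') != 0)
                                == ((c == c') || nth false b (maxn c c')))
                    (iota 0 (size w))) (iota 0 (size w)).

Definition has_orthogonal_columns (w : seq (seq int)) (d : seq int) : bool :=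
  all (fun j => all (fun k => foldr (fun v s => v`_j * v`_k + s) 0 w
                              == d`_j *+ (j == k)) (iota 0 3)) (iota 0 3).

(** As [phi] is monotone, the later of two vertices lies in the later class, so the bit of that
    class in [b'] decides adjacency between distinct classes. *)
Lemma q_le_blowup (R : realType) n b b' (w : seq (seq int)) (d S : seq int)
    (phi : nat -> nat) :
  represents w b' -> has_orthogonal_columns w d ->
  0 \in S -> all [in S] d -> size d = 3 ->
  (forall i, i < n -> phi i < size w)%N ->
  (forall c, c < size w -> exists2 i, i < n & phi i = c)%N ->
  (forall i j, i < j < n -> phi i <= phi j /\
     nth false b j = (phi i == phi j) || nth false b' (phi j))%N ->
  (q R (threshold_graph n b) <= size S)%N.
Proof.
move=> wb' wd S0 /allP dS sd phi_lt phi_onto phi_adj.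
pose W : 'M[R]_(size w, 3) := \matrix_(c, j) ((nth [::] w c)`_j)%:~R.
have WE c c' : (W *m W^T) c c' = (dot3 (nth [::] w c) (nth [::] w c'))%:~R.
  rewrite !mxE !big_ord_recl big_ord0 !mxE /= /dot3 addr0 addrA.
  by rewrite !rmorphD !rmorphM.
have Wadj c c' : ((W *m W^T) c c' != 0) = (c == c') || nth false b' (maxn c c').
  rewrite WE intr_eq0; move/allP: wb' => /(_ c); rewrite mem_iota ltn_ord.
  by move=> /(_ isT)/allP/(_ c'); rewrite mem_iota ltn_ord => /(_ isT)/eqP.
rewrite -(size_map (fun x : int => x%:~R : R)).
apply: (@q_le_gram R n _ _ _ W (fun i => Ordinal (phi_lt i (ltn_ord i)))
   (\row_j (d`_j)%:~R)).
- move=> c; have [i ilt ic] := phi_onto c (ltn_ord c).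
  by exists (Ordinal ilt); apply: val_inj.
- move=> i j ij; rewrite Wadj -val_eqE /= /threshold_adj.
  have /orP[lt|lt] : (i < j)%N || (j < i)%N by rewrite -neq_ltn.
    have [|le ->] := phi_adj i j; first by rewrite lt /=.
    by rewrite lt [(j < i)%N]ltnNge (ltnW lt) /= orbF (maxn_idPr le).
  have [|le ->] := phi_adj j i; first by rewrite lt /=.
  by rewrite lt [(i < j)%N]ltnNge (ltnW lt) /= (maxn_idPl le) eq_sym.
- apply/matrixP => j k; rewrite !mxE.
  have : foldr (fun v s => v`_j * v`_k + s) 0 w = d`_j *+ (j == k).
    move/allP: wd => /(_ j); rewrite mem_iota ltn_ord => /(_ isT)/allP/(_ k).
    by rewrite mem_iota ltn_ord => /(_ isT)/eqP.
  have -> : foldr (fun v s => v`_j * v`_k + s) 0 w = \sum_(v <- w) v`_j * v`_k.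
    elim: w {wb' wd phi_lt phi_onto W WE Wadj} => [|v w IH].
      by rewrite big_nil.
    by rewrite big_cons /= IH.
  move/(congr1 (fun x : int => x%:~R : R)); rewrite rmorphMn /= => <-.
  rewrite (big_nth [::]) big_mkord rmorph_sum; apply: eq_bigr => c _.
  by rewrite !mxE rmorphM.
- by apply/mapP; exists 0.
- by move=> j; rewrite mxE; apply/map_f/dS/mem_nth; rewrite sd.
Qed.

(** * Threshold graphs with three zeros: adjacency and lower bounds *)

Definition three_zeros (a c1 c2 : nat) : seq bool :=
  [:: false] ++ nseq a true ++ [:: false] ++ nseq c1 true ++ [:: false]
    ++ nseq c2 true.

Lemma size_three_zeros a c1 c2 :
  size (three_zeros a c1 c2) = (a + c1 + c2 + 3)%N.
Proof. by rewrite /three_zeros !size_cat !size_nseq /=; lia. Qed.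

Lemma nth_three_zeros a c1 c2 j : (j < a + c1 + c2 + 3)%N ->
  nth false (three_zeros a c1 c2) j
    = ~~ [|| j == 0, j == a.+1 | j == (a + c1).+2]%N.
Proof.
move=> jlt; rewrite /three_zeros.
case: j jlt => [|j] jlt //=; rewrite nth_cat size_nseq nth_nseq.
case: (ltnP j a) => ja; first by lia.
case: (j - a)%N (subnKC ja) => [|k] jE /=; first by lia.
rewrite nth_cat size_nseq nth_nseq; case: (ltnP k c1) => kc; first by lia.
case: (k - c1)%N (subnKC kc) => [|l] kE /=; first by lia.
by rewrite nth_nseq; case: ltnP; lia.
Qed.

Section ThreeZeros.
Variables (R : realType) (n a c1 c2 : nat).
Hypothesis nE : n = (a + c1 + c2 + 3)%N.
Local Notation G := (threshold_graph n (three_zeros a c1 c2)).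

(** The zero at position 0 needs no test: the larger of two indices is never 0. *)
Lemma three_zerosE (i j : 'I_n) : threshold_adj (three_zeros a c1 c2) i j =
  ((i < j) && ~~ ((j == a.+1 :> nat) || (j == (a + c1).+2 :> nat))
   || (j < i) && ~~ ((i == a.+1 :> nat) || (i == (a + c1).+2 :> nat)))%N.
Proof.
rewrite /threshold_adj !nth_three_zeros -?nE //.
by case: (nat_of_ord j) => [|?]; case: (nat_of_ord i) => [|?].
Qed.

Lemma three_zeros_q_gt1 : (0 < c2)%N -> (1 < q R G)%N.
Proof.
move=> c2_gt0; have n0 : (0 < n)%N by lia.
have nn : (n.-1 < n)%N by lia.
apply: (@q_gt1 R _ _ (Ordinal n0) (Ordinal nn)).
by rewrite /= three_zerosE /=; lia.
Qed.

(** The last zero has the final vertex as its only neighbour, and vertex 0 shares it. *)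
Lemma q_gt2_last_one : c2 = 1%N -> (2 < q R G)%N.
Proof.
move=> c2E; have n0 : (0 < n)%N by lia.
have nu : ((a + c1).+2 < n)%N by lia.
have nn : (n.-1 < n)%N by lia.
apply: (@q_gt2_unique_common_neighbour R _ _ (Ordinal n0) (Ordinal nu)
  (Ordinal nn)) => //.
  by rewrite /= three_zerosE /=; lia.
by move=> k /=; rewrite -val_eqE /= !three_zerosE /=; have := ltn_ord k; lia.
Qed.

(** The three zeros are pairwise non-adjacent, and the last two have only the final two vertices as
    neighbours. *)
Lemma q_gt2_last_two : c1 = 0%N -> c2 = 2%N -> (2 < q R G)%N.
Proof.
move=> c1E c2E; have n0 : (0 < n)%N by lia.
have nu : (a.+1 < n)%N by lia.
have nw : (a.+2 < n)%N by lia.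
have nk : (a.+3 < n)%N by lia.
have nl : (a.+4 < n)%N by lia.
apply: (@q_gt2_two_common_neighbours R _ _ (Ordinal n0) (Ordinal nu)
  (Ordinal nw) (Ordinal nk) (Ordinal nl)).
all: try by rewrite /= ?inE -?val_eqE /=; lia.
all: try by rewrite /= three_zerosE /=; lia.
all: move=> k /=; rewrite -!val_eqE /= !three_zerosE /=.
all: by have := ltn_ord k; lia.
Qed.

(** * Explicit vectors for the upper bounds *)

Lemma q_le3_c1_gt0 : (0 < c1)%N -> c2 = 1%N -> (q R G <= 3)%N.
Proof.
move=> c1_gt0 c2E.
(* Vertices 0 to [a] form one clique of twins, because vertex 0 is adjacent to the ones that follow
   it. *)
pose phi i := (if i <= a then 0 else if i == a.+1 then 1
  else if i < (a + c1).+2 then 2 else if i == (a + c1).+2 then 3 else 4)%N.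
apply: (@q_le_blowup R n _ [:: false; false; true; false; true]
  [:: [:: 0; 2; -2]; [:: 2; -1; -1]; [:: 1; -1; 0]; [:: 1; 1; 1]; [:: 1; 2; 1]]
  [:: 7; 11; 7] [:: 0; 7; 11] phi) => //.
- by move=> i _; rewrite /phi; do ?case: ifP => _.
- by move=> [|[|[|[|[|]]]]] // _; [ exists 0%N | exists a.+1 | exists a.+2
    | exists (a + c1).+2 | exists (a + c1).+3]; rewrite /phi //; try lia;
    do ?case: ifP => ? /=; lia.
move=> i j ijn; rewrite nth_three_zeros; last by lia.
by rewrite /phi; do ?case: ifP => ? /=; lia.
Qed.

Lemma q_le2_c1_gt0 : (0 < c1)%N -> (1 < c2)%N -> (q R G <= 2)%N.
Proof.
move=> c1_gt0 c2_gt1.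
(* The final block is split into its first vertex and the rest, possible since [c2] is at least 2.
   The extra vector lets all columns have the same squared norm 34. *)
pose phi i := (if i <= a then 0 else if i == a.+1 then 1
  else if i < (a + c1).+2 then 2 else if i == (a + c1).+2 then 3
  else if i == (a + c1).+3 then 4 else 5)%N.
apply: (@q_le_blowup R n _ [:: false; false; true; false; true; true]
  [:: [:: 4; 0; 0]; [:: 0; 5; 0]; [:: 4; -1; 0]; [:: 0; 0; 4]; [:: 1; 2; 3];
      [:: 1; 2; -3]]
  [:: 34; 34; 34] [:: 0; 34] phi) => //.
- by move=> i _; rewrite /phi; do ?case: ifP => _.
- by move=> [|[|[|[|[|[|]]]]]] // _; [ exists 0%N | exists a.+1 | exists a.+2
    | exists (a + c1).+2 | exists (a + c1).+3 | exists (a + c1).+4];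
    rewrite /phi //; try lia;
    do ?case: ifP => ? /=; lia.
move=> i j ijn; rewrite nth_three_zeros; last by lia.
by rewrite /phi; do ?case: ifP => ? /=; lia.
Qed.

Lemma q_le3_c1_eq0 : c1 = 0%N -> (0 < c2)%N -> (q R G <= 3)%N.
Proof.
move=> c1E c2_gt0.
pose phi i := (if i <= a then 0 else if i == a.+1 then 1
  else if i == a.+2 then 2 else 3)%N.
(* The first three vectors are orthogonal of norm 3, so they contribute 9 I; the last one adds 1 to
   the third entry only. *)
apply: (@q_le_blowup R n _ [:: false; false; false; true]
  [:: [:: 2; 1; 2]; [:: 1; 2; -2]; [:: 2; -2; -1]; [:: 0; 0; 1]]
  [:: 9; 9; 10] [:: 0; 9; 10] phi) => //.
- by move=> i _; rewrite /phi; do ?case: ifP => _.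
- by move=> [|[|[|[|]]]] // _; [ exists 0%N | exists a.+1 | exists a.+2
    | exists a.+3]; rewrite /phi //; try lia;
    do ?case: ifP => ? /=; lia.
move=> i j ijn; rewrite nth_three_zeros; last by lia.
by rewrite /phi; do ?case: ifP => ? /=; lia.
Qed.

Lemma q_le2_c1_eq0 : c1 = 0%N -> (2 < c2)%N -> (q R G <= 2)%N.
Proof.
move=> c1E c2_gt2.
(* The final block is split into three classes, hence the bound on [c2]; the three zeros get
   multiples of the coordinate vectors. *)
pose phi i := (if i <= a then 0 else if i == a.+1 then 1
  else if i == a.+2 then 2 else if i == a.+3 then 3
  else if i == a.+4 then 4 else 5)%N.
apply: (@q_le_blowup R n _ [:: false; false; false; true; true; true]
  [:: [:: 6; 0; 0]; [:: 0; 3; 0]; [:: 0; 0; 6]; [:: 2; 2; 2]; [:: 1; 4; -2];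
      [:: 2; -4; -1]]
  [:: 45; 45; 45] [:: 0; 45] phi) => //.
- by move=> i _; rewrite /phi; do ?case: ifP => _.
- by move=> [|[|[|[|[|[|]]]]]] // _; [ exists 0%N | exists a.+1 | exists a.+2
    | exists a.+3 | exists a.+4 | exists a.+4.+1]; rewrite /phi //; try lia;
    do ?case: ifP => ? /=; lia.
move=> i j ijn; rewrite nth_three_zeros; last by lia.
by rewrite /phi; do ?case: ifP => ? /=; lia.
Qed.

End ThreeZeros.

(** * The exact value of [q] and the four families *)

(** The boolean [c1 == 0] counts as 0 or 1: the value 2 needs [c2] above 1 if [c1] is positive and
    above 2 otherwise. The remaining cases are c2 = 1, and c1 = 0 with c2 = 2. *)
Lemma q_three_zeros (R : realType) n (G : simple_graph n) a c1 c2 :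
  (0 < c2)%N -> has_creation_sequence G (three_zeros a c1 c2) ->
  q R G = if ((c1 == 0%N).+1 < c2)%N then 2%N else 3%N.
Proof.
move=> c2_gt0 Gb; have nE : n = (a + c1 + c2 + 3)%N.
  by case: Gb => sb _ _; rewrite -sb size_three_zeros.
rewrite (q_creation_sequence R Gb); have q1 := three_zeros_q_gt1 R nE c2_gt0.
case: ltnP => c2E; apply/eqP; rewrite eqn_leq ?q1 ?andbT.
  case: (posnP c1) c2E => [c1E|c1_gt0] c2E.
    by apply: q_le2_c1_eq0 => //; rewrite c1E in c2E.
  by apply: q_le2_c1_gt0 => //; lia.
have [c2E1|c2_neq1] := eqVneq c2 1%N.
  rewrite (q_gt2_last_one R nE c2E1) andbT.
  by case: (posnP c1) => ?; [exact: q_le3_c1_eq0 | exact: q_le3_c1_gt0].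
have [c1E c2E2] : c1 = 0%N /\ c2 = 2%N by lia.
by rewrite (q_gt2_last_two R nE c1E c2E2) andbT q_le3_c1_eq0.
Qed.

Local Close Scope ring_scope.

Theorem theorem9p1 (R : realType) (n : nat) (G : simple_graph n)
    (b : seq bool) (Gb : has_creation_sequence G b) (Gconn : connected_graph G)
    (Tb : (trace b + 3)%N = n) :
  [/\ forall t1 t2 t3 : nat, 1 <= t1 -> 1 <= t2 -> 1 <= t3 ->
        has_creation_sequence G ([:: false] ++ nseq t1 true ++ [:: false]
          ++ nseq t2 true ++ [:: false] ++ nseq t3 true) ->
        (t3 = 1 -> q R G = 3) /\ (t3 <> 1 -> q R G = 2),
      forall t1 : nat, 1 <= t1 ->
        has_creation_sequence G ([:: false; false; false] ++ nseq t1 true) ->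
        (3 <= t1 -> q R G = 2) /\ (t1 = 1 \/ t1 = 2 -> q R G = 3),
      forall t1 t2 : nat, 1 <= t1 -> 1 <= t2 ->
        has_creation_sequence G ([:: false; false] ++ nseq t1 true
          ++ [:: false] ++ nseq t2 true) ->
        (t2 = 1 -> q R G = 3) /\ (2 <= t2 -> q R G = 2)
    & forall t1 t2 : nat, 1 <= t1 -> 1 <= t2 ->
        has_creation_sequence G ([:: false] ++ nseq t1 true
          ++ [:: false; false] ++ nseq t2 true) ->
        (t2 = 1 \/ t2 = 2 -> q R G = 3) /\ (3 <= t2 -> q R G = 2)].
Proof.
split.
- move=> t1 t2 t3 t1_gt0 t2_gt0 t3_gt0 Gs.
  rewrite (@q_three_zeros R n G t1 t2 t3 t3_gt0 Gs).
  by case: t2 t2_gt0 {Gs} => // t2 _ /=; split; case: ifP; lia.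
(* Empty blocks [nseq 0 true] vanish by computation, so [Gs] is accepted as a statement on
   [three_zeros]. *)
- move=> t1 t1_gt0 Gs; rewrite (@q_three_zeros R n G 0 0 t1 t1_gt0 Gs).
  by split; case: ifP; lia.
- move=> t1 t2 t1_gt0 t2_gt0 Gs.
  rewrite (@q_three_zeros R n G 0 t1 t2 t2_gt0 Gs).
  by case: t1 t1_gt0 {Gs} => // t1 _ /=; split; case: ifP; lia.
- move=> t1 t2 t1_gt0 t2_gt0 Gs.
  rewrite (@q_three_zeros R n G t1 0 t2 t2_gt0 Gs).
  by split; case: ifP; lia.
Qed.
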